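(* Let $k\ge 2$, $R>1$, and let $\mathcal{D}$ be a distribution over $\mathbb{R}$ with mean $\mu\in[-R,R]$ and $\mathbb{E}_{X\sim\mathcal{D}}[|X-\mu|^k]\le 1$. Then for all $\varepsilon,\alpha,\beta>0$ there exists an $\varepsilon$-differentially private algorithm which, given $$n \geq c\left(\frac{\log(1/\beta)}{\alpha^2} + \frac{\log(1/\beta)}{\varepsilon\,\alpha^{k/(k-1)}} + \frac{\log(R)\log(1/\beta)}{\varepsilon}\right)$$ i.i.d. samples from $\mathcal{D}$ (for a suitable absolute constant $c$), outputs $\hat\mu\in\mathbb{R}$ such that with probability at least $1-\beta$, $|\mu-\hat\mu|\le\alpha$.
   Context: A randomized algorithm $M$ on datasets is $\varepsilon$-differentially private if for every pair of datasets $X,X'$ differing in exactly one entry and every measurable set $Y$ of outputs, $\Pr[M(X)\in Y]\le e^{\varepsilon}\Pr[M(X')\in Y]$.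
   Formalization: As stated, no absolute constant c works for β near 1 or for α and ε both large; the formal theorem additionally assumes β ≤ 1/2 or β ≥ 1, and that α ≤ 1 or ε ≤ 1 or α ≥ R. *)

(* Defs.v *)
From HB Require Import structures.
From mathcomp Require Import all_boot all_order all_algebra.
From mathcomp Require Import all_classical all_reals all_analysis.

Set Implicit Arguments.
Unset Strict Implicit.
Unset Printing Implicit Defensive.

Import Order.TTheory GRing.Theory Num.Theory.
Import numFieldNormedType.Exports.

Local Open Scope classical_set_scope.
Local Open Scope ring_scope.
Local Open Scope ereal_scope.

(* A randomized algorithm on real datasets of size n with a real output: M x Y
   is the probability, over the internal coins, that the output on x is in Y. *)
Definition mechanism (R : realType) (n : nat) : Type :=
  R.-pker (n.-tuple (measurableTypeR R)) ~> (measurableTypeR R).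

Definition neighbouring (T : eqType) (n : nat) (x y : n.-tuple T) : Prop :=
  #|[pred i : 'I_n | tnth x i != tnth y i]| = 1%N.

Definition differentially_private (R : realType) (n : nat) (eps : R)
    (M : mechanism R n) : Prop :=
  forall x x' : n.-tuple (measurableTypeR R), neighbouring x x' ->
  forall Y : set (measurableTypeR R), measurable Y ->
    M x Y <= (expR eps)%:E * M x' Y.

(* The product rule for subfamilies is the case A i = setT off the subfamily. *)
Definition mutually_independent (d : measure_display) (T : measurableType d)
    (R : realType) (P : probability T R) (n : nat)
    (X : 'I_n -> {RV P >-> measurableTypeR R}) : Prop :=
  forall A : 'I_n -> set (measurableTypeR R), (forall i, measurable (A i)) ->
    P (\bigcap_(i : 'I_n) (X i @^-1` A i)) = \prod_(i < n) P (X i @^-1` A i).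

Definition iid_samples (d : measure_display) (T : measurableType d)
    (R : realType) (P : probability T R)
    (D : probability (measurableTypeR R) R) (n : nat)
    (X : 'I_n -> {RV P >-> measurableTypeR R}) : Prop :=
  mutually_independent X /\
  forall (i : 'I_n) (A : set (measurableTypeR R)), measurable A ->
    distribution P (X i) A = D A.

Definition has_mean (R : realType) (D : probability (measurableTypeR R) R)
    (mu : R) : Prop :=
  D.-integrable [set: measurableTypeR R] (fun x => (x : R)%:E) /\
  'E_D[fun x => x : R] = mu%:E.

(* Probability over both the samples and the internal coins of M. *)
Definition output_probability (d : measure_display) (T : measurableType d)
    (R : realType) (P : probability T R) (n : nat) (M : mechanism R n)
    (X : 'I_n -> {RV P >-> measurableTypeR R})
    (Y : set (measurableTypeR R)) : \bar R :=
  \int[P]_w M [tuple (X i w : measurableTypeR R) | i < n] Y.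

(* Main.v *)
Require Import Defs.
From HB Require Import structures.
From mathcomp Require Import all_boot all_order all_algebra finmap.
From mathcomp Require Import all_classical all_reals all_analysis.
From mathcomp Require Import measurable_realfun zify ring lra.

Import Order.TTheory GRing.Theory Num.Theory.
Import numFieldNormedType.Exports HBNNSimple.

Local Open Scope classical_set_scope.
Local Open Scope ring_scope.

(* Clipped (Huber-type) estimating equation plus the exponential mechanism.
   Put rho ~ alpha ^ (- 1 / (k - 1)) and let clip truncate to [-1, 1]. The score
   of a candidate y is |T(y)|, T(y) = \sum_i clip ((x_i - y) / rho), which changes
   by at most 2 between neighbouring datasets, so sampling a point of an
   alpha/64-grid of [-r, r] with weight exp (- eps |T(y)| / 4) is eps-private.
   - Clipping at scale rho biases E[clip ((X - mu) / rho)] by O(alpha / rho), and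
     its second moment is O(1 / rho ^ 2); hence |T(mu)| <= n alpha / (16 rho)
     outside an event of probability exp (- Omega(n alpha ^ 2)).
   - If at most half of the samples are at distance >= rho / 2 from mu, then T has
     slope at most - n / (2 rho) near mu and is monotone, so
     |T(y)| + |T(y0)| >= (n / 2) min (|y - y0| / rho, 1 / 4) for all y at once,
     where y0 is the grid point next to mu. No union bound over y is needed.
   - The weights of the bad candidates are therefore dominated by a geometric
     series of ratio exp (- Omega(eps n alpha ^ (k / (k - 1)))), plus O(r / alpha)
     terms of size exp (- Omega(eps n)). *)

(** * Induction principle for nonnegative measurable functions *)

Section ge0_measurable_induction.
Local Open Scope ereal_scope.
Context {d : measure_display} {T : measurableType d} {R : realType}.
Variable K : (T -> \bar R) -> Prop.

Hypothesis K_indic : forall A, measurable A -> K (EFin \o \1_A).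
Hypothesis K_lin : forall (r : R) (f g : T -> \bar R), (0 <= r)%R ->
  measurable_fun setT f -> measurable_fun setT g ->
  (forall x, 0 <= f x) -> (forall x, 0 <= g x) ->
  K f -> K g -> K (fun x => r%:E * f x + g x).
Hypothesis K_lim : forall (f : (T -> \bar R)^nat) (g : T -> \bar R),
  (forall n, measurable_fun setT (f n)) -> (forall n x, 0 <= f n x) ->
  (forall x, {homo f ^~ x : m n / (m <= n)%N >-> m <= n}) ->
  (forall n, K (f n)) -> (forall x, f ^~ x @ \oo --> g x) -> K g.

(** A nonnegative measurable function is an increasing limit of simple functions, each a finite
    combination of indicators of its level sets; the hypotheses on [K] follow these two steps. *)
Lemma ge0_measurable_ind (f : T -> \bar R) :
  measurable_fun setT f -> (forall x, 0 <= f x) -> K f.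
Proof.
move=> mf f0; pose f_ := nnsfun_approx measurableT mf.
apply: (K_lim (fun n x => (f_ n x)%:E) f).
- by move=> n; exact/measurable_EFinP/measurable_funP.
- by move=> n x; rewrite lee_fin.
- by move=> x m n mn; rewrite lee_fin; by have /lefP := nd_nnsfun_approx measurableT mf mn; exact.
- move=> n; move: (f_ n) => h {f_}.
  have -> : (fun x => (h x)%:E) = fun x => \sum_(y <- fset_set (range h))
      y%:E * (EFin \o \1_(h @^-1` [set y])) x.
    apply/funext => x /=; rewrite [in LHS]fimfunE fsbig_finite//= sumEFin.
    by apply: congr1; apply: eq_bigr.
  (* Measurability and nonnegativity of the partial sums travel along with [K], because [K_lin] asks
     for them. *)
  suff [] : [/\ K (fun x => \sum_(y <- fset_set (range h))
        y%:E * (EFin \o \1_(h @^-1` [set y])) x),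
      measurable_fun setT (fun x => \sum_(y <- fset_set (range h))
        y%:E * (EFin \o \1_(h @^-1` [set y])) x) &
      forall x, 0 <= \sum_(y <- fset_set (range h))
        y%:E * (EFin \o \1_(h @^-1` [set y])) x] by [].
  have : forall y, y \in (fset_set (range h) : seq R) -> (0 <= y)%R.
    move=> y ys; have : y \in fset_set (range h) by [].
    by rewrite in_fset_set// inE => -[x _ <-]; exact: fun_ge0.
  elim: (fset_set (range h) : seq R) => [_|y s ih hs].
    split; last by move=> x; rewrite big_nil.
    - under eq_fun do rewrite big_nil.
      by have := K_indic set0 measurable0; rewrite indic0; exact.
    - by under eq_fun do rewrite big_nil; exact: measurable_cst.
  have [|Ks ms s0] := ih.
    by move=> z zs; apply: hs; rewrite inE zs orbT.
  have y0 : (0 <= y)%R by apply: hs; rewrite inE eqxx.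
  have mi : measurable_fun setT (EFin \o \1_(h @^-1` [set y]) : T -> \bar R).
    by apply/measurable_EFinP; exact: measurable_indic.
  split.
  - under eq_fun do rewrite big_cons.
    apply: K_lin => //; first by move=> x; rewrite lee_fin.
    exact: K_indic.
  - under eq_fun do rewrite big_cons.
    apply: emeasurable_funD => //.
    by apply: emeasurable_funM => //; exact: measurable_cst.
  - by move=> x; rewrite big_cons adde_ge0// mule_ge0// lee_fin.
- by move=> x; apply: cvg_nnsfun_approx.
Qed.

End ge0_measurable_induction.

(** * Expectations of products of independent variables *)

Section independence.
Local Open Scope ereal_scope.
Context {d : measure_display} {T : measurableType d} {R : realType}.
Variables (P : probability T R) (n : nat).
Variable X : 'I_n -> {RV P >-> measurableTypeR R}.
Hypothesis indepX : mutually_independent X.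

(** The factors are freed from being indicators one index at a time: those of index below [m] are
    arbitrary. For [m = 0] the claim is the product rule for events. *)
Let expectation_prod_indep_rec (m : nat) (f : 'I_n -> measurableTypeR R -> R) :
  (forall i, measurable_fun setT (f i)) -> (forall i x, 0 <= f i x)%R ->
  (forall i, \int[P]_w (f i (X i w))%:E < +oo) ->
  (forall i : 'I_n, (m <= i)%N -> exists2 A, measurable A & f i = \1_A) ->
  \int[P]_w \prod_(i < n) (f i (X i w))%:E =
  \prod_(i < n) \int[P]_w (f i (X i w))%:E.
Proof.
elim: m f => [|m ih] f mf f0 foo fA.
  have {fA} /(_ _)/cid2-/all_sig2[A mA fA] : forall i, exists2 A, measurable A & f i = \1_A.
    by move=> i; exact: fA.
  have mXA i : measurable (X i @^-1` A i).
    by rewrite -[X in measurable X]setTI; apply: (measurable_funPT (X i)).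
  transitivity (P (\bigcap_(i : 'I_n) (X i @^-1` A i))).
    have mcap : measurable (\bigcap_(i : 'I_n) (X i @^-1` A i)).
      by apply: fin_bigcap_measurable => //; exact: finite_finset.
    rewrite -[X in _ = P X]setIT -(integral_indic P measurableT mcap).
    apply: eq_integral => w _; rewrite prodEFin; apply: congr1.
    rewrite indicE; have [|/negP wA] := boolP (w \in _).
      rewrite inE => wA; rewrite big1// => i _; rewrite fA indicE mem_set//.
      exact: wA.
    have /existsNP[i /not_implyP[_ iA]] : ~ (forall i, setT i -> A i (X i w)).
      by move=> h; apply: wA; rewrite inE.
    by rewrite (bigD1 i)//= fA indicE memNset// mul0r.
  rewrite indepX//; apply: eq_bigr => i _.
  rewrite -[X in P X = _]setIT -(integral_indic P measurableT (mXA i)).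
  by apply: eq_integral => w _; rewrite fA.
have [nm|mn] := leqP n m.
  by apply: ih => // i mi; have := ltn_ord i; rewrite ltnNge (leq_trans nm mi).
pose i0 := Ordinal mn.
pose G w : R := (\prod_(i < n | i != i0) f i (X i w))%R.
pose C := \prod_(i < n | i != i0) \int[P]_w (f i (X i w))%:E.
have mfX i : measurable_fun setT (fun w => f i (X i w)).
  exact: (measurableT_comp (mf i)).
have mG : measurable_fun setT G.
  by rewrite /G; under eq_fun do rewrite -big_filter; exact: measurable_prod.
have G0 w : (0 <= G w)%R by exact: prodr_ge0.
(* Finiteness lets multiplication by [C] commute with the monotone limit in the last case. *)
have Cfin : C \is a fin_num.
  apply: prode_fin_num => i _; rewrite ge0_fin_numE//.
  by apply: integral_ge0 => w _; rewrite lee_fin.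
(* All factors except the one at [i0] are frozen in [G]. Both sides are now linear and monotonically
   continuous in [g], and for an indicator the identity is the induction hypothesis. *)
suff key (g : measurableTypeR R -> \bar R) : measurable_fun setT g -> (forall x, 0 <= g x) ->
    \int[P]_w (g (X i0 w) * (G w)%:E) = C * \int[P]_w g (X i0 w).
  transitivity (\int[P]_w ((f i0 (X i0 w))%:E * (G w)%:E)).
    apply: eq_integral => w _.
    by rewrite (bigD1 i0)//= prodEFin.
  rewrite (key (EFin \o f i0)); last 2 first.
  - exact/measurable_EFinP.
  - by move=> x; rewrite lee_fin.
  by rewrite [RHS](bigD1 i0)//= muleC.
have mc (h : measurableTypeR R -> \bar R) :
    measurable_fun setT h -> measurable_fun setT (fun w => h (X i0 w)).
  by move=> mh; exact: (measurableT_comp mh).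
have mcG (h : measurableTypeR R -> \bar R) :
    measurable_fun setT h -> measurable_fun setT (fun w => h (X i0 w) * (G w)%:E).
  by move=> mh; apply: emeasurable_funM; [exact: mc|exact/measurable_EFinP].
have cG0 (h : measurableTypeR R -> \bar R) : (forall x, 0 <= h x) ->
    forall w, 0 <= h (X i0 w) * (G w)%:E.
  by move=> h0 w; rewrite mule_ge0// lee_fin.
move: g; apply: ge0_measurable_ind.
- move=> A mA.
  pose h i := if i == i0 then \1_A else f i.
  have [mh h0] : (forall i, measurable_fun setT (h i)) /\ (forall i x, 0 <= h i x)%R.
    by split=> i; rewrite /h; case: ifP.
  have hoo i : \int[P]_w (h i (X i w))%:E < +oo.
    rewrite /h; case: ifP => // _.
    have mXA : measurable (X i @^-1` A).
      by rewrite -[X in measurable X]setTI; apply: (measurable_funPT (X i)).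
    have -> : \int[P]_w (\1_A (X i w))%:E = P (X i @^-1` A `&` setT).
      exact: (integral_indic P measurableT mXA).
    by rewrite setIT; exact: le_lt_trans (probability_le1 _ mXA) (ltry _).
  transitivity (\int[P]_w \prod_(i < n) (h i (X i w))%:E).
    apply: eq_integral => w _; rewrite (bigD1 i0)//= /h eqxx prodEFin.
    by congr (_ * _%:E); apply: eq_bigr => i /negbTE ->.
  rewrite (ih h mh h0 hoo).
    rewrite (bigD1 i0)//= muleC.
    congr (_ * _); last by apply: eq_integral => w _; rewrite /h eqxx.
    by apply: eq_bigr => i /negbTE ii0; rewrite /h ii0.
  move=> i mi; rewrite /h; case: eqVneq => [_|ii0]; first by exists A.
  apply: fA; rewrite ltn_neqAle mi andbT; apply: contra ii0 => /eqP mi'.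
  exact/eqP/val_inj.
- move=> r u v r0 mu mv u0 v0 Ku Kv.
  under eq_integral do rewrite ge0_muleDl ?mule_ge0 ?lee_fin// -muleA.
  rewrite ge0_integralD//; last 4 first.
  + by move=> w _; rewrite !mule_ge0 ?lee_fin.
  + by apply: emeasurable_funM => //; exact: mcG.
  + by move=> w _; exact: cG0.
  + exact: mcG.
  rewrite ge0_integralZl_EFin//; [|by move=> w _; exact: cG0|exact: mcG].
  rewrite Ku Kv ge0_integralD//; last 3 first.
  + by move=> w _; rewrite mule_ge0 ?lee_fin.
  + by apply: emeasurable_funM => //; exact: mc.
  + exact: mc.
  rewrite ge0_integralZl_EFin//; [|exact: mc].
  have : 0 <= \int[P]_w u (X i0 w) by exact: integral_ge0.
  have : 0 <= \int[P]_w v (X i0 w) by exact: integral_ge0.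
  move: (\int[P]_w u (X i0 w)) (\int[P]_w v (X i0 w)) => a b b0 a0.
  rewrite [RHS]muleDr//; first by rewrite muleCA.
  by apply: ge0_adde_def; rewrite inE ?mule_ge0 ?lee_fin.
- move=> u v mu u0 nd Ku uv.
  have h1 : \int[P]_w (u k (X i0 w) * (G w)%:E) @[k --> \oo] -->
      \int[P]_w (v (X i0 w) * (G w)%:E).
    have -> : \int[P]_w (v (X i0 w) * (G w)%:E) =
        \int[P]_w limn (fun k => u k (X i0 w) * (G w)%:E).
      apply: eq_integral => w _; apply/esym/cvg_lim => //.
      by apply: cvgeZr => //; exact: uv.
    apply: cvg_monotone_convergence => //.
    + by move=> k; exact: mcG.
    + by move=> k w _; exact: cG0.
    + by move=> w _ a b ab; rewrite lee_wpmul2r ?lee_fin//; exact: nd.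
  have h2 : \int[P]_w u k (X i0 w) @[k --> \oo] --> \int[P]_w v (X i0 w).
    have -> : \int[P]_w v (X i0 w) = \int[P]_w limn (fun k => u k (X i0 w)).
      by apply: eq_integral => w _; apply/esym/cvg_lim => //; exact: uv.
    apply: cvg_monotone_convergence => //.
    by move=> k; exact: mc.
  have h3 := cvgeZl Cfin h2.
  rewrite -(cvg_lim (@ereal_hausdorff R) h1) -(cvg_lim (@ereal_hausdorff R) h3).
  congr (limn _).
  by apply/funext => k; exact: Ku.
Qed.

Lemma expectation_prod_indep (f : 'I_n -> measurableTypeR R -> R) :
  (forall i, measurable_fun setT (f i)) -> (forall i x, 0 <= f i x)%R ->
  (forall i, \int[P]_w (f i (X i w))%:E < +oo) ->
  \int[P]_w \prod_(i < n) (f i (X i w))%:E =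
  \prod_(i < n) \int[P]_w (f i (X i w))%:E.
Proof.
move=> mf f0 foo; apply: (expectation_prod_indep_rec n) => // i.
by rewrite leqNgt ltn_ord.
Qed.

End independence.

Lemma measurable_set_ler {d : measure_display} {T : measurableType d}
    {R : realType} (f g : T -> R) :
  measurable_fun setT f -> measurable_fun setT g ->
  measurable [set w | f w <= g w].
Proof.
move=> mf mg; rewrite -[X in measurable X]setTI.
by have := measurable_fun_ler mf mg measurableT (Y := [set true]); apply.
Qed.

(** * Chernoff bound for i.i.d. samples *)

Section concentration.
Local Open Scope ereal_scope.
Context {d : measure_display} {T : measurableType d} {R : realType}.
Variables (P : probability T R) (D : probability (measurableTypeR R) R).
Variables (n : nat) (X : 'I_n -> {RV P >-> measurableTypeR R}).
Hypothesis iidX : iid_samples D X.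

Lemma integral_iid (i : 'I_n) (g : measurableTypeR R -> \bar R) :
  measurable_fun setT g -> (forall x, 0 <= g x) ->
  \int[P]_w g (X i w) = \int[D]_x g x.
Proof.
move=> mg g0; rewrite -(ge0_integral_distribution (X i))//.
by apply: eq_measure_integral => A mA _; apply: iidX.2.
Qed.

(** Exponential Markov inequality, then factorization by independence. The usual tilting parameter
    is absorbed into [f], which callers scale beforehand. *)
Lemma iid_chernoff (f : measurableTypeR R -> R) (a s : R) :
  measurable_fun setT f ->
  \int[D]_x (expR (f x))%:E <= (expR a)%:E ->
  P [set w | (s <= \sum_(i < n) f (X i w))%R] <= (expR (n%:R * a - s))%:E.
Proof.
move=> mf fa.
have me : measurable_fun setT (fun x => expR (f x)).
  by apply: measurableT_comp mf.
have mfX i : measurable_fun setT (fun w => f (X i w)).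
  exact: (measurableT_comp mf).
have mS : measurable_fun setT (fun w => \sum_(i < n) f (X i w))%R.
  exact: measurable_sum.
have ei i : \int[P]_w (expR (f (X i w)))%:E = \int[D]_x (expR (f x))%:E.
  apply: (integral_iid i (EFin \o (fun x => expR (f x)))).
    exact/measurable_EFinP.
  by move=> x; rewrite lee_fin expR_ge0.
have E0 : 0 <= \int[D]_x (expR (f x))%:E.
  by apply: integral_ge0 => x _; rewrite lee_fin expR_ge0.
have mA : measurable [set w | (s <= \sum_(i < n) f (X i w))%R].
  exact: measurable_set_ler.
apply: (@le_trans _ _
    (\int[P]_w ((expR (- s))%:E * \prod_(i < n) (expR (f (X i w)))%:E))).
  rewrite -[X in P X]setIT -(integral_indic P measurableT mA).
  apply: ge0_le_integral => //.
  - by apply/measurable_EFinP.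
  - under eq_fun do rewrite prodEFin -EFinM.
    apply/measurable_EFinP; apply: measurable_funM => //.
    by apply: measurable_prod => i _; exact: measurableT_comp (mfX i).
  - move=> w _; rewrite prodEFin -EFinM lee_fin -expR_sum -expRD indicE.
    have [|] := boolP (w \in _); last by rewrite expR_ge0.
    by rewrite inE /= => sw; rewrite -expR0 ler_expR; lra.
rewrite ge0_integralZl_EFin ?expR_ge0//; last 2 first.
- by move=> w _; rewrite prode_ge0// => i _; rewrite lee_fin expR_ge0.
- under eq_fun do rewrite prodEFin.
  apply/measurable_EFinP.
  by apply: measurable_prod => i _; exact: measurableT_comp (mfX i).
rewrite (expectation_prod_indep P n X iidX.1 (fun=> fun x => expR (f x)))//; last first.
  by move=> i; rewrite ei (le_lt_trans fa)// ltry.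
under eq_bigr do rewrite ei.
have -> : (expR (n%:R * a - s))%:E = (expR (- s))%:E * \prod_(i < n) (expR a)%:E.
  by rewrite prodEFin -EFinM prodr_const card_ord -expRM_natl -expRD addrC.
rewrite lee_wpmul2l ?lee_fin ?expR_ge0//.
move: fa E0; move: (\int[D]_x _) => e fa e0.
suff [] : 0 <= \prod_(i < n) e /\ \prod_(i < n) e <= \prod_(i < n) (expR a)%:E by [].
elim/big_rec2 : _ => [|i x y _ [x0 xy]]; first by rewrite lee01.
by split; [exact: mule_ge0|exact: lee_pmul].
Qed.

End concentration.

(** * The exponential mechanism on finitely many candidates *)

Section exponential_mechanism.
Local Open Scope ereal_scope.
Context {d d' : measure_display} {T : measurableType d} {U : measurableType d'}
  {R : realType}.
Variables (N : nat) (y : nat -> U) (u : nat -> T -> R).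

Definition softmax (j : nat) (x : T) : R :=
  (expR (u j x) / \sum_(l < N.+1) expR (u l x))%R.

Lemma sum_expR_gt0 (x : T) : (0 < \sum_(l < N.+1) expR (u l x))%R.
Proof.
rewrite big_ord_recl ltr_wpDr ?expR_gt0//.
by apply: sumr_ge0 => i _; exact: expR_ge0.
Qed.

Lemma softmax_ge0 (j : nat) (x : T) : (0 <= softmax j x)%R.
Proof. by rewrite divr_ge0 ?expR_ge0// ltW// sum_expR_gt0. Qed.

Lemma softmax_sum1 (x : T) : (\sum_(j < N.+1) softmax j x = 1)%R.
Proof. by rewrite -mulr_suml divff// gt_eqF// sum_expR_gt0. Qed.

Definition softmax_measure (x : T) : {measure set U -> \bar R} :=
  msum (fun j => mscale (NngNum (softmax_ge0 j x)) (dirac (y j))) N.+1.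

Lemma softmax_measureE (x : T) (A : set U) :
  softmax_measure x A = (\sum_(j < N.+1) softmax j x * \1_A (y j))%:E.
Proof. by rewrite /softmax_measure/= /msum -sumEFin; apply: eq_bigr. Qed.

Hypothesis mu : forall j, measurable_fun setT (u j).

Lemma measurable_softmax (j : nat) : measurable_fun setT (softmax j).
Proof.
(* Writing the quotient as the exponential of a difference reduces measurability to that of sums,
   [ln] and [expR]. *)
have -> : softmax j =
    fun x => expR (u j x - ln (\sum_(l < N.+1) expR (u l x))%R)%R.
  by apply/funext => x; rewrite expRB lnK// posrE sum_expR_gt0.
apply: measurableT_comp => //; apply: measurable_funB => //.
apply: measurableT_comp; first exact: measurable_ln.
by apply: measurable_sum => l; exact: measurableT_comp.
Qed.

(** The measurability proof is an argument so that the kernel instances below, which depend on it,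
    can attach to the term. *)
Definition softmax_kernel of (forall j, measurable_fun setT (u j)) :=
  softmax_measure.

Let measurable_softmax_kernel (A : set U) : measurable A ->
  measurable_fun setT (softmax_kernel mu ^~ A).
Proof.
move=> mA; rewrite /softmax_kernel; under eq_fun do rewrite softmax_measureE.
apply/measurable_EFinP; apply: measurable_sum => j.
by apply: measurable_funM => //; exact: measurable_softmax.
Qed.

HB.instance Definition _ := isKernel.Build _ _ _ _ _ (softmax_kernel mu)
  measurable_softmax_kernel.

Let softmax_kernelT (x : T) : softmax_kernel mu x setT = 1.
Proof.
rewrite /softmax_kernel softmax_measureE indicT.
by under eq_bigr do rewrite mulr1; rewrite softmax_sum1.
Qed.

HB.instance Definition _ := Kernel_isProbability.Build _ _ _ _ _
  (softmax_kernel mu) softmax_kernelT.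

Definition exponential_mechanism : R.-pker T ~> U := softmax_kernel mu.

Lemma exponential_mechanismE (x : T) (A : set U) :
  exponential_mechanism x A = (\sum_(j < N.+1) softmax j x * \1_A (y j))%:E.
Proof. exact: softmax_measureE. Qed.

(** The numerator and the normalizing sum each change by a factor of at most [expR (e / 2)]. *)
Lemma softmax_sensitivity (x x' : T) (e : R) :
  (forall j, `|u j x - u j x'| <= e / 2)%R ->
  forall j, (softmax j x <= expR e * softmax j x')%R.
Proof.
move=> ue j; rewrite /softmax.
have e1 l : (expR (u l x) <= expR (e / 2) * expR (u l x'))%R.
  by rewrite -expRD ler_expR; have := ue l; rewrite ler_norml; lra.
have e2 l : (expR (u l x') <= expR (e / 2) * expR (u l x))%R.
  by rewrite -expRD ler_expR; have := ue l; rewrite ler_norml; lra.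
rewrite [leRHS]mulrA ler_pdivlMr ?sum_expR_gt0// mulrAC.
rewrite ler_pdivrMr ?sum_expR_gt0//.
have -> : (expR e = expR (e / 2) * expR (e / 2))%R.
  by rewrite -expRD; congr expR; lra.
rewrite -[leRHS]mulrA mulrACA; apply: ler_pM => //.
- exact/ltW/sum_expR_gt0.
- by rewrite mulr_sumr; apply: ler_sum.
Qed.

End exponential_mechanism.

(** * Clipping and elementary inequalities *)

Ltac split_ifs := repeat match goal with
  | |- context [if ?a < ?b then _ else _] => case: (ltP a b)
  end; move=> *.

Section clipping.
Context {R : realType}.
Implicit Types (x y v t D : R).

Definition clip x : R := Num.max (-1) (Num.min 1 x).

Lemma clip_id x : `|x| <= 1 -> clip x = x.
Proof.
rewrite ler_norml /clip /Num.max /Num.min => /andP[? ?].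
by split_ifs; lra.
Qed.

Lemma le_clip x y : x <= y -> clip x <= clip y.
Proof.
by rewrite /clip /Num.max /Num.min; split_ifs; lra.
Qed.

Lemma norm_clip_le1 x : `|clip x| <= 1.
Proof.
by rewrite ler_norml /clip /Num.max /Num.min; split_ifs; lra.
Qed.

Lemma norm_clip_le x : `|clip x| <= `|x|.
Proof.
have [x1|x1] := leP `|x| 1; first by rewrite clip_id.
by rewrite (le_trans (norm_clip_le1 x))// ltW.
Qed.

Lemma clip_lipschitz x y : `|clip x - clip y| <= `|x - y|.
Proof.
wlog xy : x y / x <= y.
  by move=> h; case: (leP x y) => [/h//|/ltW/h]; rewrite distrC [leRHS]distrC.
rewrite distrC [leRHS]distrC !ger0_norm ?subr_ge0 ?le_clip//.
by rewrite /clip /Num.max /Num.min; split_ifs; lra.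
Qed.

Lemma norm_clip_sub_le x : `|clip x - x| <= `|x|.
Proof.
have [x0|x0] := leP 0 x.
  rewrite (ger0_norm x0) ler_norml.
  by rewrite /clip /Num.max /Num.min; split_ifs; lra.
rewrite (ltr0_norm x0) ler_norml.
by rewrite /clip /Num.max /Num.min; split_ifs; lra.
Qed.

Lemma measurable_clip : measurable_fun [set: R] clip.
Proof.
by apply: measurable_maxr => //; apply: measurable_minr.
Qed.

Lemma clip_gap x D : `|x| <= 3 / 4 -> 0 <= D ->
  Num.min D (1 / 4) <= clip x - clip (x - D) /\
  Num.min D (1 / 4) <= clip (x + D) - clip x.
Proof.
move=> x34 D0; rewrite (clip_id x); last lra.
move: x34; rewrite ler_norml => /andP[? ?].
by rewrite /clip /Num.max /Num.min; split_ifs; lra.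
Qed.

(** From exp(-t) >= 1 - t one gets exp(t) <= 1 / (1 - t), and (1 - t)(1 + t + 2t^2) = 1 + t^2 (1 -
    2t) >= 1. *)
Lemma expR_le_quadratic t : t <= 1 / 2 -> expR t <= 1 + t + 2 * t ^+ 2.
Proof.
move=> t2.
have h : 1 - t <= expR (- t) by have := expR_ge1Dx (- t); rewrite addrC; lra.
have p : 0 < 1 - t by lra.
have -> : expR t = (expR (- t))^-1 by rewrite expRN invrK.
apply: (@le_trans _ _ (1 - t)^-1); first by rewrite lef_pV2// posrE expR_gt0.
rewrite -div1r ler_pdivrMr//.
have := sqr_ge0 t; rewrite expr2 => s; nra.
Qed.

Lemma sqr_le_powR (k x : R) : 2 <= k -> x ^+ 2 <= 1 + `|x| `^ k.
Proof.
move=> k2; rewrite -(real_normK (num_real x)); have x0 := normr_ge0 x.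
have p0 := powR_ge0 `|x| k.
have [x1|x1] := leP `|x| 1; first by have := exprn_ile1 2 x0 x1; lra.
have : `|x| `^ 2 <= `|x| `^ k by apply: ler_powR => //; lra.
by rewrite powR_mulrn//; lra.
Qed.

End clipping.

(** * Geometric sums *)

Section geometric.
Context {R : realType}.

Lemma sum_geometric_le (q : R) (m : nat) : 0 <= q <= 1 / 2 ->
  \sum_(i < m) q ^+ i.+1 <= 2 * q.
Proof.
move=> /andP[q0 q2].
have e : (1 - q) * \sum_(i < m) q ^+ i.+1 = q * (1 - q ^+ m).
  have -> : 1 - q ^+ m = (1 - q) * \sum_(i < m) q ^+ i.
    have := subrX1 q m; move: (\sum_(i < m) q ^+ i) => S e.
    by rewrite -opprB e; ring.
  rewrite [RHS]mulrCA; congr (_ * _); rewrite mulr_sumr.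
  by apply: eq_bigr => i _; rewrite exprS.
have qm : 0 <= q ^+ m by rewrite exprn_ge0.
have S0 : 0 <= \sum_(i < m) q ^+ i.+1 by apply: sumr_ge0 => i _; rewrite exprn_ge0.
nra.
Qed.

(** With truncated subtraction the exponent is the distance between [j] and [j0]; each side of [j0]
    contributes at most [2 * q]. *)
Lemma sum_geometric_dist_le (q : R) (N j0 : nat) : 0 <= q <= 1 / 2 ->
  (j0 <= N)%N ->
  \sum_(j < N.+1 | j != j0 :> nat) q ^+ (j - j0 + (j0 - j))%N <= 4 * q.
Proof.
move=> q01 j0N.
rewrite -(big_mkord (fun j => j != j0) (fun j => q ^+ (j - j0 + (j0 - j))%N)).
rewrite (@big_cat_nat _ _ _ j0)//=; last exact: leqW.
rewrite [X in _ + X]big_ltn_cond ?ltnS//= eqxx/=.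
have -> : 4 * q = 2 * q + 2 * q by ring.
apply: lerD.
  apply: le_trans (sum_geometric_le q j0 q01).
  rewrite big_nat_rev/= add0n big_mkord le_eqVlt; apply/orP; left; apply/eqP.
  by apply: eq_big => i; [have := ltn_ord i; lia|move=> _; congr (_ ^+ _);
    have := ltn_ord i; lia].
apply: le_trans (sum_geometric_le q (N.+1 - j0.+1) q01).
rewrite -{1}(add0n j0.+1) big_addn big_mkord le_eqVlt; apply/orP; left; apply/eqP.
by apply: eq_big => i; [lia|move=> _; congr (_ ^+ _); lia].
Qed.

End geometric.

(** * The clipped estimating equation *)

Section huber.
Context {R : realType} {n : nat}.
Implicit Types (z : 'I_n -> R) (rho y mu : R).

(** Up to the factor -1 / [rho], this is the derivative in [y] of the Huber loss with threshold
    [rho]. *)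
Definition huber rho y z : R := \sum_(i < n) clip ((z i - y) / rho).

Definition outlier rho mu : R -> R := \1_[set x | rho / 2 <= `|x - mu|].

Lemma huber_lipschitz rho y y' z : 0 < rho ->
  `|huber rho y z| <= `|huber rho y' z| + n%:R * (`|y - y'| / rho).
Proof.
move=> rho0; rewrite -lerBlDl (le_trans (lerB_dist _ _))//.
rewrite -sumrB (le_trans (ler_norm_sum _ _ _))//.
rewrite mulr_natl -[n in leRHS]card_ord -sumr_const.
apply: ler_sum => i _; rewrite (le_trans (clip_lipschitz _ _))//.
rewrite -mulrBl normrM (ger0_norm (x := rho^-1)) ?invr_ge0 ?(ltW rho0)//.
have -> : z i - y - (z i - y') = - (y - y') by ring.
by rewrite normrN.
Qed.

(** A non-outlier satisfies |z_i - y0| / rho <= 1/2 + 1/64 <= 3/4, so [clip_gap] applies to it. An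
    outlier cannot cancel its contribution, since [clip] is monotone. *)
Lemma huber_gap rho mu y0 y z : 64 <= rho -> `|y0 - mu| <= 1 ->
  \sum_(i < n) outlier rho mu (z i) <= n%:R / 2 ->
  n%:R / 2 * Num.min (`|y - y0| / rho) (1 / 4) <=
  `|huber rho y z| + `|huber rho y0 z|.
Proof.
move=> rho64 y0mu Bn; set m := Num.min _ _; set B := outlier rho mu in Bn.
have rho0 : 0 < rho by lra.
have m0 : 0 <= m by rewrite le_min divr_ge0 ?normr_ge0 ?(ltW rho0)//=; lra.
suff key : n%:R / 2 * m <= `|huber rho y z - huber rho y0 z|.
  by rewrite (le_trans key)// ler_normB.
(* Each non-outlier contributes at least [m], each outlier at least 0. *)
apply: (@le_trans _ _ (\sum_(i < n) (1 - B (z i)) * m)).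
  by rewrite -mulr_suml sumrB sumr_const card_ord ler_wpM2r//; lra.
have good i : B (z i) = 0 -> `|(z i - y0) / rho| <= 3 / 4.
  rewrite /B /outlier indicE; case: (boolP (_ \in _)) => [_ /eqP|]; first by rewrite oner_eq0.
  rewrite notin_setE /= => /negP; rewrite -ltNge => zi _.
  rewrite normrM (ger0_norm (x := rho^-1)) ?invr_ge0 ?(ltW rho0)// ler_pdivrMr//.
  have : `|z i - y0| <= `|z i - mu| + `|y0 - mu|.
    by rewrite (distrC y0); exact: ler_distD.
  lra.
have B01 i : B (z i) = 0 \/ B (z i) = 1.
  by rewrite /B /outlier indicE; case: (_ \in _); [right|left].
have [yy0|/ltW y0y] := leP y0 y.
- rewrite distrC (le_trans _ (ler_norm _))// -sumrB; apply: ler_sum => i _.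
  have e : (z i - y) / rho = (z i - y0) / rho - (y - y0) / rho by rewrite -mulrBl; congr (_ / _); ring.
  have D0 : 0 <= (y - y0) / rho by rewrite divr_ge0 ?subr_ge0 ?(ltW rho0).
  have [Bi|->] := B01 i; last first.
    by rewrite subrr mul0r subr_ge0 le_clip// e; lra.
  rewrite Bi subr0 mul1r e /m ger0_norm ?subr_ge0//.
  by have [] := clip_gap _ _ (good _ Bi) D0.
- rewrite (le_trans _ (ler_norm _))// -sumrB; apply: ler_sum => i _.
  have e : (z i - y) / rho = (z i - y0) / rho + (y0 - y) / rho by rewrite -mulrDl; congr (_ / _); ring.
  have D0 : 0 <= (y0 - y) / rho by rewrite divr_ge0 ?subr_ge0 ?(ltW rho0).
  have [Bi|->] := B01 i; last first.
    by rewrite subrr mul0r subr_ge0 le_clip// e; lra.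
  rewrite Bi subr0 mul1r e /m distrC ger0_norm ?subr_ge0//.
  by have [] := clip_gap _ _ (good _ Bi) D0.
Qed.

End huber.

Lemma huber_sensitivity {R : realType} (n : nat) (rho y : R)
    (x x' : n.-tuple (measurableTypeR R)) : neighbouring x x' ->
  `|huber rho y (tnth x) - huber rho y (tnth x')| <= 2.
Proof.
move=> /mem_card1[i0 xx'].
have e i : i != i0 -> tnth x i = tnth x' i.
  by move=> ii0; apply/eqP; have := xx' i; rewrite !inE (negbTE ii0) => /negbFE.
rewrite /huber (bigD1 i0)//= [X in _ - X](bigD1 i0)//=.
rewrite (eq_bigr (fun i => clip ((tnth x' i - y) / rho))); last first.
  by move=> i ii0; rewrite e.
rewrite opprD addrACA subrr addr0 (le_trans (ler_normB _ _))//.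
by rewrite (le_trans (lerD (norm_clip_le1 _) (norm_clip_le1 _)))//; lra.
Qed.

(** The normalizing sum is at least its term at [j0], so a candidate [j] has probability at most
    [expR (u j x - u j0 x)]. Summing over the candidates outside [A] gives a two-sided geometric
    series plus [N.+1] copies of [h]. *)
Lemma softmax_tail {d : measure_display} {T : measurableType d} {U : Type}
    {R : realType} (N : nat) (y : nat -> U)
    (u : nat -> T -> R) (x : T) (j0 : nat) (q h : R) (A : set U) :
  (j0 <= N)%N -> 0 <= q <= 1 / 2 -> 0 <= h ->
  (forall j, (j <= N)%N -> ~ A (y j) -> j != j0 /\
     expR (u j x - u j0 x) <= q ^+ (j - j0 + (j0 - j))%N + h) ->
  1 - (4 * q + N.+1%:R * h) <= \sum_(j < N.+1) softmax N u j x * \1_A (y j).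
Proof.
move=> j0N q01 h0 hA; have q0 : 0 <= q by case/andP: q01.
rewrite lerBlDr -lerBlDl -[X in X - _](softmax_sum1 N u x) -sumrB.
apply: (@le_trans _ _ (\sum_(j < N.+1)
    ((if j != j0 :> nat then q ^+ (j - j0 + (j0 - j))%N else 0) + h))).
  apply: ler_sum => j _; rewrite indicE.
  have [Ay|/negP Ay] := boolP (y j \in A).
    by rewrite mulr1 subrr addr_ge0//; case: ifP => // _; rewrite exprn_ge0.
  have nAy : ~ A (y j) by move=> Ay'; apply: Ay; rewrite inE.
  have [-> hj] := hA j (ltn_ord j) nAy.
  rewrite mulr0 subr0 (le_trans _ hj)// expRB ler_wpM2l ?expR_ge0//.
  rewrite lef_pV2 ?posrE ?expR_gt0 ?sum_expR_gt0//.
  have j0N1 : (j0 < N.+1)%N by [].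
  rewrite (bigD1 (Ordinal j0N1))//= lerDl.
  by apply: sumr_ge0 => i _; rewrite expR_ge0.
rewrite big_split/=; apply: lerD; last by rewrite sumr_const card_ord mulr_natl.
by rewrite -big_mkcond/=; exact: sum_geometric_dist_le.
Qed.

Lemma measurable_dist {R : realType} (mu : R) :
  measurable_fun [set: measurableTypeR R] (fun x : R => `|x - mu|).
Proof.
apply: (@measurableT_comp _ _ _ _ _ _ (@Num.norm R R)) => //.
exact: measurable_funB.
Qed.

(** * Exponential moments under the bound on the central moment *)

Section moments.
Context {R : realType}.
Variables (D : probability (measurableTypeR R) R) (mu k : R).
Hypothesis hk : 2 <= k.
Hypothesis meanD : has_mean D mu.
Hypothesis momD : ('E_D[fun x => (`|(x : R) - mu| `^ k)%R] <= 1)%E.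

Lemma measurable_central_moment :
  measurable_fun [set: measurableTypeR R] (fun x : R => `|x - mu| `^ k).
Proof.
apply: (@measurableT_comp _ _ _ _ _ _ (@powR R ^~ k)) => //.
exact: measurable_dist.
Qed.

Lemma integrable_central_moment :
  D.-integrable [set: measurableTypeR R] (fun x : R => (`|x - mu| `^ k)%:E).
Proof.
apply/integrableP; split.
  by apply/measurable_EFinP; exact: measurable_central_moment.
apply: le_lt_trans (ltry 1); apply: le_trans momD; rewrite unlock.
rewrite le_eqVlt; apply/orP; left; apply/eqP; apply: eq_integral => x _.
by rewrite gee0_abs// lee_fin powR_ge0.
Qed.

(** The linear term of the majorant integrates to 0 because [mu] is the mean, and the last term to
    at most [c]. *)
Lemma integral_le_central_moment (g : R -> R) (a b c : R) : 0 <= c ->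
  measurable_fun [set: measurableTypeR R] g -> (forall x, 0 <= g x) ->
  (forall x, g x <= a + b * (x - mu) + c * `|x - mu| `^ k) ->
  (\int[D]_x (g x)%:E <= (a + c)%:E)%E.
Proof.
move=> c0 mg g0 gle.
have ix := meanD.1.
have icst (r : R) : D.-integrable [set: measurableTypeR R] (fun=> r%:E).
  exact: finite_measure_integrable_cst.
have ixmu : D.-integrable [set: measurableTypeR R] (fun x : R => (x%:E - mu%:E)%E).
  exact: integrableB.
have ib : D.-integrable [set: measurableTypeR R]
    (fun x : R => (b%:E * (x%:E - mu%:E))%E).
  exact: integrableZl.
have ic : D.-integrable [set: measurableTypeR R]
    (fun x : R => (c%:E * (`|x - mu| `^ k)%:E)%E).
  by apply: integrableZl => //; exact: integrable_central_moment.
have iab : D.-integrable [set: measurableTypeR R]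
    (fun x : R => (a%:E + b%:E * (x%:E - mu%:E))%E).
  exact: integrableD.
apply: (@le_trans _ _ (\int[D]_x
    (a%:E + b%:E * ((x : R)%:E - mu%:E) + c%:E * (`|(x : R) - mu| `^ k)%:E))%E).
  apply: ge0_le_integral => //.
  - by move=> x _; rewrite lee_fin.
  - exact/measurable_EFinP.
  - exact: measurable_int (integrableD _ iab ic).
  - by move=> x _; rewrite -EFinB -!EFinM -!EFinD lee_fin.
rewrite integralD// integralD// integralZl// integralB//.
rewrite integralZl//; last exact: integrable_central_moment.
have intc (r : R) : (\int[D]_x r%:E = r%:E)%E.
  transitivity (r%:E * D setT)%E; first exact: integral_cst.
  by rewrite probability_setT mule1.
rewrite !intc.
have -> : (\int[D]_x (x : R)%:E = mu%:E)%E by have := meanD.2; rewrite unlock.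
rewrite subee// mule0 adde0 EFinD leeD2l// -[leRHS]mule1 lee_wpmul2l//.
by have := momD; rewrite unlock.
Qed.

(** Expand the exponential to second order. With s = (alpha/256)^2, the quadratic term costs 2s +
    2s|w|^k and the clipping bias 4s|w|^k, which gives 1 + 8s <= exp(8s) in total. *)
Lemma mgf_clip_le (alpha rho t : R) :
  0 < alpha -> 64 <= rho -> 64 <= alpha * rho `^ (k - 1) -> `|t| <= 1 / 4 ->
  `|t| = alpha * rho / 256 ->
  (\int[D]_x (expR (t * clip (((x : R) - mu) / rho)))%:E <=
     (expR (8 * (alpha / 256) ^+ 2))%:E)%E.
Proof.
move=> alpha0 rho64 hrho t4 te.
have rho0 : 0 < rho by lra.
pose s := (alpha / 256) ^+ 2.
have ts : `|t| / rho = alpha / 256.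
  by rewrite te mulrAC mulfK// gt_eqF.
have ts2 : (t / rho) ^+ 2 = s.
  rewrite -(real_normK (num_real (t / rho))) normrM normfV (gtr0_norm rho0) ts.
  by [].
apply: (@le_trans _ _ (1 + 2 * s + 6 * s)%:E); last first.
  rewrite lee_fin (le_trans _ (expR_ge1Dx _))//.
  by rewrite -/s; lra.
apply: (integral_le_central_moment _ _ (t / rho)).
- by rewrite mulr_ge0// sqr_ge0.
- apply: measurableT_comp => //; apply: measurable_funM => //.
  apply: measurableT_comp; first exact: measurable_clip.
  by apply: measurable_funM => //; apply: measurable_funB.
- by move=> x; rewrite expR_ge0.
move=> x; set w := x - mu.
have c1 := norm_clip_le1 (w / rho).
have tc : t * clip (w / rho) <= 1 / 2.
  rewrite (le_trans (ler_norm _))// normrM.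
  by rewrite (le_trans (ler_pM _ _ t4 c1))//; lra.
apply: le_trans (expR_le_quadratic _ tc) _.
have sq : (t * clip (w / rho)) ^+ 2 <= s + s * `|w| `^ k.
  have -> : s + s * `|w| `^ k = s * (1 + `|w| `^ k) by ring.
  rewrite -ts2 -[leLHS]real_normK ?num_real// normrM exprMn.
  apply: (@le_trans _ _ (`|t| ^+ 2 * `|w / rho| ^+ 2)).
    by rewrite ler_wpM2l ?exprn_ge0// lerXn2r ?nnegrE// norm_clip_le.
  rewrite !real_normK ?num_real//.
  have -> : t ^+ 2 * (w / rho) ^+ 2 = (t / rho) ^+ 2 * w ^+ 2.
    by rewrite !expr_div_n; ring.
  by rewrite ler_wpM2l ?sqr_ge0// sqr_le_powR.
(* Clipping only acts for |w| > rho, where |w| <= |w|^k / rho^(k-1) <= (alpha/64) |w|^k. *)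
have bias : t * clip (w / rho) <= t / rho * w + 4 * s * `|w| `^ k.
  have -> : t * clip (w / rho) = t / rho * w + t * (clip (w / rho) - w / rho).
    by rewrite (mulrBr t) -(mulrA t) (mulrC rho^-1) [RHS]addrC subrK.
  rewrite lerD2l (le_trans (ler_norm _))// normrM.
  have p0 := powR_ge0 `|w| k.
  have s0 : 0 <= s by rewrite -ts2 sqr_ge0.
  have [w1|w1] := leP `|w / rho| 1.
    by rewrite clip_id// subrr normr0 mulr0 mulr_ge0// mulr_ge0.
  rewrite (le_trans (ler_wpM2l (normr_ge0 t) (norm_clip_sub_le _)))//.
  rewrite normrM normfV (gtr0_norm rho0) mulrCA ts.
  have wr : rho <= `|w|.
    move: w1; rewrite normrM normfV (gtr0_norm rho0) ltr_pdivlMr// mul1r.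
    exact: ltW.
  have w0 : 0 < `|w| by lra.
  have -> : `|w| `^ k = `|w| * `|w| `^ (k - 1).
    rewrite -{2}(powRr1 (normr_ge0 w)) -powRD; last by rewrite (gt_eqF w0) implybT.
    by congr (_ `^ _); ring.
  have h1 : rho `^ (k - 1) <= `|w| `^ (k - 1).
    apply: ge0_ler_powR => //; rewrite ?nnegrE ?(ltW rho0)//.
    by rewrite subr_ge0 (le_trans _ hk)// ler1n.
  have h2 : 64 <= alpha * `|w| `^ (k - 1).
    by rewrite (le_trans hrho)// ler_wpM2l// ltW.
  have -> : 4 * s * (`|w| * `|w| `^ (k - 1)) =
      `|w| * (alpha / 256) * ((alpha * `|w| `^ (k - 1)) / 64).
    by rewrite /s; field.
  apply: ler_peMr; last by rewrite ler_pdivlMr// mul1r.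
  by rewrite mulr_ge0// divr_ge0// ltW.
rewrite (_ : 1 + 2 * s + t / rho * w + 6 * s * `|w| `^ k =
  1 + (t / rho * w + 4 * s * `|w| `^ k) + 2 * (s + s * `|w| `^ k)); last by ring.
by apply: lerD; [lra|lra].
Qed.

(** On an outlier |x - mu|^k >= 32^2 = 1024, so e <= 4 is below 1 + |x - mu|^k / 256. *)
Lemma mgf_outlier_le (rho : R) : 64 <= rho ->
  (\int[D]_x (expR (outlier rho mu (x : R)))%:E <= (expR (1 / 256))%:E)%E.
Proof.
move=> rho64.
apply: (@le_trans _ _ (1 + 1 / 256)%:E); last first.
  by rewrite lee_fin; exact: expR_ge1Dx.
apply: (integral_le_central_moment _ _ 0) => //.
  apply: measurableT_comp => //; apply: measurable_indic.
  by apply: measurable_set_ler => //; exact: measurable_dist.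
move=> x; rewrite mul0r addr0 /outlier indicE; have p0 := powR_ge0 `|x - mu| k.
have [|_] := boolP (_ \in _); last by rewrite expR0; lra.
rewrite inE /= => hx.
have : `|x - mu| `^ 2 <= `|x - mu| `^ k by apply: ler_powR => //; lra.
rewrite powR_mulrn ?normr_ge0// expr2.
have e2 : expR (1 / 2) <= 2 :> R by have := expR_le_quadratic _ (lexx (1 / 2 : R)); lra.
have e4 : expR 1 <= 4 :> R.
  rewrite (_ : 1 = 1 / 2 + 1 / 2 :> R); last lra.
  by rewrite expRD; have := expR_ge0 (1 / 2 : R); nra.
have : 32 * 32 <= `|x - mu| * `|x - mu| by apply: ler_pM => //; lra.
rewrite mulr1n; lra.
Qed.

End moments.

(** * The private mechanism on a grid and its accuracy on good samples *)

Section huber_mechanism.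
Context {R : realType}.
Variables (n : nat) (r rho delta eps : R).

Definition grid (j : nat) : measurableTypeR R := - r + j%:R * delta.

Definition grid_size : nat := Num.truncn (2 * r / delta).

(** The factor [eps / 4] turns the sensitivity 2 of [huber] into the [eps / 2] required by
    [softmax_sensitivity]. *)
Definition huber_score (j : nat) (x : n.-tuple (measurableTypeR R)) : R :=
  - (eps / 4) * `|huber rho (grid j) (tnth x)|.

Lemma measurable_huber_score (j : nat) : measurable_fun setT (huber_score j).
Proof.
apply: measurable_funM => //.
apply: (@measurableT_comp _ _ _ _ _ _ (@Num.norm R R)) => //.
apply: measurable_sum => i.
apply: measurableT_comp; first exact: measurable_clip.
apply: measurable_funM => //; apply: measurable_funB => //.
exact: measurable_tnth.
Qed.

Definition huber_mechanism : mechanism R n :=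
  exponential_mechanism grid_size grid huber_score measurable_huber_score.

Lemma huber_mechanism_private : 0 < eps ->
  differentially_private eps huber_mechanism.
Proof.
move=> eps0 x x' xx' Y mY; rewrite !exponential_mechanismE -EFinM lee_fin.
rewrite mulr_sumr; apply: ler_sum => j _; rewrite mulrA ler_wpM2r//.
apply: softmax_sensitivity => i.
rewrite /huber_score -mulrBr normrM normrN (gtr0_norm (x := eps / 4)) ?divr_gt0//.
have -> : eps / 2 = eps / 4 * 2 by field.
rewrite ler_pM2l ?divr_gt0//.
exact: le_trans (ler_dist_dist _ _) (huber_sensitivity _ _ _ _ _ xx').
Qed.

Lemma grid_dist (i j : nat) : 0 < delta ->
  `|grid i - grid j| = (i - j + (j - i))%N%:R * delta.
Proof.
move=> delta0; rewrite /grid.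
have -> : - r + i%:R * delta - (- r + j%:R * delta) = (i%:R - j%:R) * delta by ring.
rewrite normrM (gtr0_norm delta0); congr (_ * _).
have [ij|/ltnW ij] := leqP i j.
  rewrite distrC -natrB// ger0_norm//; congr _%:R; lia.
by rewrite -natrB// ger0_norm//; congr _%:R; lia.
Qed.

Lemma grid_approx (mu : R) : 0 < delta -> - r <= mu <= r ->
  exists2 j, (j <= grid_size)%N & `|grid j - mu| <= delta.
Proof.
move=> delta0 /andP[mur rmu]; exists (Num.truncn ((mu + r) / delta)).
  by apply: le_truncn; rewrite ler_pM2r ?invr_gt0//; lra.
have /truncn_itv/andP[] : 0 <= (mu + r) / delta by rewrite divr_ge0 ?(ltW delta0)//; lra.
rewrite /grid; move: (Num.truncn _) => j; rewrite ler_pdivlMr// ltr_pdivrMr// => h1 h2.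
by rewrite -natr1 mulrDl mul1r in h2; rewrite ler_norml; lra.
Qed.

End huber_mechanism.

(** Deterministic in the sample. Here [q] bounds the loss of weight per grid step, and the
    exponential beside [grid_size] covers the candidates for which the gap is capped at 1/4. *)
Lemma huber_mechanism_accurate {R : realType} (n : nat) (r rho alpha eps mu : R)
    (x : n.-tuple (measurableTypeR R))
    (q := expR (- (eps * n%:R / 16 * (alpha / 64 / rho)))) :
  0 < eps -> 0 < alpha <= 1 -> 64 <= rho -> - r <= mu <= r -> q <= 1 / 2 ->
  \sum_(i < n) outlier rho mu (tnth x i) <= n%:R / 2 ->
  `|huber rho mu (tnth x)| <= n%:R * (alpha / (16 * rho)) ->
  ((1 - (4 * q + (grid_size r (alpha / 64)).+1%:R *
             expR (- (eps * n%:R / 64))))%:E <=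
   huber_mechanism n r rho (alpha / 64) eps x
     [set m : measurableTypeR R | (`|mu - (m : R)| <= alpha)%R])%E.
Proof.
move=> eps0 /andP[alpha0 alpha1] rho64 hmu q2 hout hT.
set delta := alpha / 64.
have delta0 : 0 < delta by rewrite divr_gt0.
have rho0 : 0 < rho by lra.
have en0 : 0 <= eps * n%:R by rewrite mulr_ge0// ltW.
have [j0 j0N hj0] := grid_approx r delta mu delta0 hmu.
rewrite exponential_mechanismE lee_fin.
apply: (softmax_tail _ _ _ _ j0) => //; first by rewrite expR_ge0.
move=> j jN /= /negP; rewrite -ltNge => hj.
have alphaE : alpha = 64 * delta by rewrite /delta; field.
(* A bad candidate is more than [64 * delta] from [mu], and the grid point [j0] is within [delta] of
   it. *)
have jj0 : `|grid r delta j - grid r delta j0| >= 63 * delta.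
  have := ler_distD (grid r delta j0) mu (grid r delta j).
  by rewrite (distrC mu (grid r delta j0)) (distrC (grid r delta j0) (grid r delta j)); lra.
split.
  by apply/eqP => jj; move: jj0; rewrite jj subrr normr0; lra.
set y0 := grid r delta j0 in hj0 jj0 *; set y := grid r delta j in hj jj0 *.
set m := Num.min (`|y - y0| / rho) (1 / 4).
have gap : n%:R / 2 * m <= `|huber rho y (tnth x)| + `|huber rho y0 (tnth x)|.
  apply: huber_gap hout => //.
  by rewrite (le_trans hj0)//; lra.
have S0 : `|huber rho y0 (tnth x)| <= n%:R * (5 * (delta / rho)).
  apply: le_trans (huber_lipschitz rho y0 mu (tnth x) rho0) _.
  have -> : n%:R * (5 * (delta / rho)) =
      n%:R * (alpha / (16 * rho)) + n%:R * (delta / rho).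
    by rewrite alphaE; field; rewrite gt_eqF.
  by apply: lerD => //; rewrite ler_wpM2l// ler_pM2r ?invr_gt0.
have m63 : 63 * (delta / rho) <= m.
  rewrite le_min; apply/andP; split.
    by rewrite mulrA ler_pM2r ?invr_gt0.
  rewrite mulrA ler_pdivrMr//; lra.
have n0 : 0 <= n%:R :> R by [].
(* The score gap |T(y)| - |T(y0)| is at least nm/2 - 2|T(y0)| >= nm/2 - 10 n delta/rho >= nm/4,
   because 63 delta/rho <= m. *)
have main : huber_score n r rho delta eps j x - huber_score n r rho delta eps j0 x <=
    - (eps * n%:R / 16 * m).
  rewrite /huber_score -/y -/y0 -mulrBr mulNr lerN2.
  have -> : eps * n%:R / 16 * m = eps / 4 * (n%:R / 4 * m) by field.
  rewrite ler_pM2l ?divr_gt0//.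
  move: (delta / rho) m63 S0 => dr m63 S0.
  have : n%:R * (63 * dr) <= n%:R * m by rewrite ler_wpM2l.
  have : 0 <= n%:R * dr.
    have := le_trans (normr_ge0 _) S0; lra.
  lra.
apply: (@le_trans _ _ (expR (- (eps * n%:R / 16 * m)))); first by rewrite ler_expR.
rewrite /m minEle; case: ifP => _.
- rewrite (grid_dist r delta j j0 delta0 : `|y - y0| = _) (_ : - _ =
    (j - j0 + (j0 - j))%N%:R * (- (eps * n%:R / 16 * (delta / rho)))); last first.
    by ring.
  by rewrite expRM_natl lerDl expR_ge0.
- rewrite (_ : eps * n%:R / 16 * (1 / 4) = eps * n%:R / 64); last by field.
  by rewrite lerDr exprn_ge0// expR_ge0.
Qed.

(** * Success probability over samples and coins *)

Lemma output_probability_ge {d : measure_display} {T : measurableType d}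
    {R : realType} (P : probability T R) (n : nat) (M : mechanism R n)
    (X : 'I_n -> {RV P >-> measurableTypeR R}) (Y : set (measurableTypeR R))
    (G : set T) (eta zeta : R) :
  measurable Y -> measurable G -> 0 <= eta <= 1 ->
  (forall w, G w ->
    ((1 - eta)%:E <= M [tuple (X i w : measurableTypeR R) | i < n] Y)%E) ->
  (P (~` G) <= zeta%:E)%E ->
  ((1 - (eta + zeta))%:E <= output_probability M X Y)%E.
Proof.
move=> mY mG /andP[eta0 eta1] hG hz.
have mX : measurable_fun setT
    (fun w => [tuple (X i w : measurableTypeR R) | i < n]).
  apply/measurable_fun_tnthP => i.
  rewrite (_ : _ \o _ = X i); first exact: measurable_funPT.
  by apply/funext => w /=; rewrite tnth_mktuple.
apply: (@le_trans _ _ (\int[P]_w ((1 - eta)%:E * (\1_G w)%:E))%E); last first.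
  apply: ge0_le_integral => //.
  - by move=> w _; rewrite -EFinM lee_fin mulr_ge0// subr_ge0.
  - by apply/measurable_EFinP; apply: measurable_funM.
  - exact: (measurableT_comp (measurable_kernel M _ mY) mX).
  - move=> w _; rewrite indicE; have [|_] := boolP (w \in G).
      by rewrite inE mule1 => /hG.
    by rewrite mule0.
rewrite ge0_integralZl_EFin ?subr_ge0//; last first.
  exact/measurable_EFinP.
have -> : (\int[P]_w (\1_G w)%:E = P G)%E.
  transitivity (P (G `&` setT)); first exact: integral_indic.
  by rewrite setIT.
have := hz; rewrite (probability_setC P mG).
have /fineK <- : P G \is a fin_num by rewrite fin_num_measure.
rewrite -EFinB -EFinM !lee_fin => h.
have : fine (P G) <= 1 by rewrite -lee_fin fineK ?fin_num_measure ?probability_le1.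
(* This is (1 - eta) P(G) >= (1 - eta)(1 - zeta) >= 1 - (eta + zeta) when zeta >= 0; in any case
   P(G) <= 1 is at hand. *)
nra.
Qed.

(** Union bound over three bad events: T(mu) too large, T(mu) too small, too many outliers. The
    mechanism runs at accuracy [alpha <= 1], while [gamma] is the accuracy demanded. *)
Lemma huber_mechanism_success {d : measure_display} {T : measurableType d}
    {R : realType} (P : probability T R) (D : probability (measurableTypeR R) R)
    (n : nat) (X : 'I_n -> {RV P >-> measurableTypeR R})
    (k r rho alpha gamma eps mu : R)
    (q := expR (- (eps * n%:R / 16 * (alpha / 64 / rho))))
    (eta := 4 * q + (grid_size r (alpha / 64)).+1%:R *
              expR (- (eps * n%:R / 64))) :
  2 <= k -> 0 < eps -> 0 < alpha <= 1 -> alpha <= gamma ->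
  64 <= rho -> alpha * rho <= 64 -> 64 <= alpha * rho `^ (k - 1) ->
  - r <= mu <= r -> has_mean D mu ->
  ('E_D[fun x => (`|(x : R) - mu| `^ k)%R] <= 1)%E ->
  iid_samples D X -> q <= 1 / 2 -> eta <= 1 ->
  ((1 - (eta + (2 * expR (- (8 * (n%:R * (alpha / 256) ^+ 2))) +
                expR (- (n%:R / 4)))))%:E <=
   output_probability (huber_mechanism n r rho (alpha / 64) eps) X
     [set m : measurableTypeR R | (`|mu - (m : R)| <= gamma)%R])%E.
Proof.
move=> k2 eps0 /[dup] alpha01 /andP[alpha0 alpha1] ag rho64 ar64 hrho hmu mean mom iid q2 eta1.
have rho0 : 0 < rho by lra.
(* [t] is the Chernoff tilt. [s] is twice the exponent [n * 8 * (alpha / 256) ^+ 2] of the moment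
   bound, and s / t = n alpha / (16 rho) is the bound needed on |T(mu)|. *)
pose t := alpha * rho / 256; pose s := n%:R * (16 * (alpha / 256) ^+ 2).
have t0 : 0 < t by rewrite divr_gt0// mulr_gt0.
have t4 : t <= 1 / 4 by rewrite /t; lra.
pose f (e : R) (x : measurableTypeR R) := e * clip (((x : R) - mu) / rho).
have mf e : measurable_fun setT (f e).
  apply: measurable_funM => //.
  apply: measurableT_comp; first exact: measurable_clip.
  by apply: measurable_funM => //; apply: measurable_funB.
have mo : measurable_fun [set: measurableTypeR R] (outlier rho mu).
  by apply: measurable_indic; apply: measurable_set_ler => //; exact: measurable_dist.
have mball e : measurable [set m : measurableTypeR R | `|mu - (m : R)| <= e].
  rewrite [X in measurable X](_ : _ = [set m | `|(m : R) - mu| <= e]); last first.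
    by apply/seteqP; split => m /=; rewrite distrC.
  by apply: measurable_set_ler => //; exact: measurable_dist.
pose E (g : measurableTypeR R -> R) (v : R) := [set w | v <= \sum_(i < n) g (X i w)].
have mE g v : measurable_fun setT g -> measurable (E g v).
  move=> mg; apply: measurable_set_ler => //; apply: measurable_sum => i.
  exact: measurableT_comp mg _.
have PE e : `|e| = t -> (P (E (f e) s) <= (expR (- (8 * (n%:R * (alpha / 256) ^+ 2))))%:E)%E.
  move=> et.
  have := iid_chernoff P D n X iid (f e) (8 * (alpha / 256) ^+ 2) s (mf e).
  rewrite (_ : n%:R * _ - s = - (8 * (n%:R * (alpha / 256) ^+ 2))); last by rewrite /s; ring.
  by apply; apply: (mgf_clip_le D mu k k2 mean mom) => //; rewrite et.
have PO : (P (E (outlier rho mu) (n%:R / 2)%R) <= (expR (- (n%:R / 4)))%:E)%E.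
  have := iid_chernoff P D n X iid (outlier rho mu) (1 / 256) (n%:R / 2) mo.
  move=> /(_ (mgf_outlier_le D mu k k2 mean mom rho rho64))/le_trans; apply.
  by rewrite lee_fin ler_expR; have : 0 <= n%:R :> R by []; lra.
pose bad := E (f t) s `|` E (f (- t)) s `|` E (outlier rho mu) (n%:R / 2).
have mbad : measurable bad.
  by apply: measurableU; [apply: measurableU|]; exact: mE.
apply: (output_probability_ge _ _ _ _ _ (~` bad)) => //.
- exact: measurableC.
- rewrite eta1 andbT; apply: addr_ge0; apply: mulr_ge0 => //; exact: expR_ge0.
- move=> w; rewrite /bad !setCU => -[[/= /negP]].
  rewrite -ltNge => h1 /negP; rewrite -ltNge => h2 /negP; rewrite -ltNge => h3.
  set x := [tuple _ | _ < n].
  have hx (g : R -> R) : \sum_(i < n) g (tnth x i) = \sum_(i < n) g (X i w).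
    by apply: eq_bigr => i _; rewrite tnth_mktuple.
  apply: (@le_trans _ _ (huber_mechanism n r rho (alpha / 64) eps x
      [set m : measurableTypeR R | (`|mu - (m : R)| <= alpha)%R])); last first.
    by apply: le_measure; rewrite ?inE// => m /= /le_trans; apply.
  apply: huber_mechanism_accurate => //.
  + by rewrite (hx (outlier rho mu)) ltW.
  + rewrite /huber (hx (fun z => clip ((z - mu) / rho))).
    move: h1 h2; rewrite /f -!mulr_sumr; move: (\sum_(i < n) _) => S h1 h2.
    have -> : n%:R * (alpha / (16 * rho)) = s / t.
      by rewrite /s /t; field; rewrite !gt_eqF.
    rewrite ler_pdivlMr// -[X in _ * X](gtr0_norm t0) -normrM ler_norml mulrC.
    by apply/andP; split; lra.
- have m1 := mE _ s (mf t); have m2 := mE _ s (mf (- t)).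
  have m3 := mE _ (n%:R / 2) mo.
  rewrite setCK; apply: le_trans (measureU2 P (measurableU _ _ m1 m2) m3) _.
  rewrite EFinD; apply: leeD => //; apply: le_trans (measureU2 P m1 m2) _.
  rewrite mulr_natl mulr2n EFinD; apply: leeD; apply: PE; rewrite ?normrN.
    exact: gtr0_norm.
  exact: gtr0_norm.
Qed.

(** * Arithmetic of the sample size *)

Lemma expRN_le_div16 {R : realType} (L v : R) :
  expR (- L) <= 1 / 2 -> 5 * L <= v -> expR (- v) <= expR (- L) / 16.
Proof.
move=> L2 Lv; apply: (@le_trans _ _ (expR (5%:R * - L))); first by rewrite ler_expR; lra.
(* Four of the five factors exp(-L) <= 1/2 yield the 1/16. *)
rewrite expRM_natl exprS; have b0 := expR_ge0 (- L).
have : expR (- L) ^+ 4 <= (1 / 2) ^+ 4 by rewrite lerXn2r ?nnegrE//; lra.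
move=> h; rewrite ler_wpM2l// (le_trans h)//.
by rewrite expr_div_n expr1n; lra.
Qed.

Section sample_size.
Context {R : realType}.
Variables (eps alpha a beta r : R) (n : nat).
Let L : R := ln (1 / beta).
Hypotheses (eps0 : 0 < eps) (alpha01 : 0 < alpha <= 1) (a01 : 0 < a <= 1).
Hypotheses (r1 : 1 < r) (beta2 : 0 < beta <= 1 / 2).
Variable c0 : R.
Hypothesis c0E : c0 = 16 * 256 ^+ 2.
Hypothesis hn : c0 *
  (L / alpha ^+ 2 + L / (eps * (a * alpha)) + ln r * L / eps) <= n%:R.

Let alpha0 : 0 < alpha. Proof. by case/andP: alpha01. Qed.
Let alpha1 : alpha <= 1. Proof. by case/andP: alpha01. Qed.
Let a0 : 0 < a. Proof. by case/andP: a01. Qed.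
Let a1 : a <= 1. Proof. by case/andP: a01. Qed.

Let expRNL : expR (- L) = beta.
Proof.
have /andP[b0 _] := beta2.
by rewrite expRN lnK ?posrE ?divr_gt0// div1r invrK.
Qed.

Let L_ge : 1 / 2 <= L.
Proof.
have /andP[_ b2] := beta2.
rewrite leNgt; apply/negP => L2.
have : expR (- (1 / 2)) < expR (- L) by rewrite ltr_expR; lra.
by rewrite expRNL; have := expR_ge1Dx (- (1 / 2) : R); lra.
Qed.

Let t1 : 0 <= L / alpha ^+ 2.
Proof. by have := L_ge => ?; rewrite divr_ge0 ?exprn_ge0 ?(ltW alpha0)//; lra. Qed.

Let t2 : 0 <= L / (eps * (a * alpha)).
Proof.
have := L_ge => ?; rewrite divr_ge0//; first lra.
by rewrite !mulr_ge0// ltW.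
Qed.

Let t3 : 0 <= ln r * L / eps.
Proof.
have := L_ge => ?; rewrite divr_ge0 ?(ltW eps0)// mulr_ge0//; last lra.
by rewrite ln_ge0// ltW.
Qed.

Let c0_ge0 : 0 <= c0.
Proof. by rewrite c0E; apply: mulr_ge0 (ler0n _ _) (sqr_ge0 _). Qed.

Let n1 : 16 * L <= n%:R * (alpha / 256) ^+ 2.
Proof.
have h : c0 * (L / alpha ^+ 2) <= n%:R.
  apply: le_trans hn; apply: (ler_wpM2l c0_ge0).
  by have := t1; have := t2; have := t3; lra.
have -> : 16 * L = c0 * (L / alpha ^+ 2) * (alpha / 256) ^+ 2.
  by rewrite c0E; field; rewrite gt_eqF.
by apply: ler_wpM2r => [|//]; exact: sqr_ge0.
Qed.

Let n1' : 64 * L <= n%:R.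
Proof.
have h : (alpha / 256) ^+ 2 <= (1 / 2) ^+ 2.
  have d0 : 0 <= alpha / 256 := divr_ge0 (ltW alpha0) (ler0n _ _).
  by rewrite lerXn2r ?nnegrE//; have := alpha1; lra.
have : n%:R * (alpha / 256) ^+ 2 <= n%:R * (1 / 2) ^+ 2 by rewrite ler_wpM2l.
by have := n1; lra.
Qed.

Let n2 : 16 * L <= eps * n%:R / 16 * (alpha / 64 / (64 / a)).
Proof.
have h : c0 * (L / (eps * (a * alpha))) <= n%:R.
  apply: le_trans hn; apply: (ler_wpM2l c0_ge0).
  by have := t1; have := t2; have := t3; lra.
have -> : 16 * L = eps * (c0 * (L / (eps * (a * alpha)))) / 16 *
    (alpha / 64 / (64 / a)).
  by rewrite c0E; field; rewrite !gt_eqF.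
rewrite ler_wpM2r// ?ler_pdivrMr ?divfK ?ler_pM2l//.
by rewrite !divr_ge0// ltW.
Qed.

Let n3 : 64 * 256 * (L / alpha + ln r * L) <= eps * n%:R / 64.
Proof.
have h : c0 * (L / (eps * (a * alpha)) + ln r * L / eps) <= n%:R.
  apply: le_trans hn; apply: (ler_wpM2l c0_ge0).
  by have := t1; have := t2; have := t3; lra.
apply: (@le_trans _ _ (eps * (c0 *
    (L / (eps * (a * alpha)) + ln r * L / eps)) / 64)); last first.
  by rewrite ler_wpM2r// ler_pM2l.
have -> : eps * (c0 *
    (L / (eps * (a * alpha)) + ln r * L / eps)) / 64 =
    64 * 256 * (L / (a * alpha) + ln r * L).
  by rewrite c0E; field; rewrite !gt_eqF.
apply: ler_wpM2l; first exact: mulr_ge0 (ler0n _ _) (ler0n _ _).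
rewrite lerD2r; apply: ler_wpM2l; first by have := L_ge; lra.
by rewrite lef_pV2 ?posrE ?mulr_gt0// ler_piMl// ltW.
Qed.

Let q_le : expR (- (eps * n%:R / 16 * (alpha / 64 / (64 / a)))) <= beta / 16.
Proof.
rewrite -expRNL; apply: expRN_le_div16.
  by rewrite expRNL; case/andP: beta2.
by apply: le_trans n2; have := L_ge; lra.
Qed.

Let grid_term_le : (grid_size r (alpha / 64)).+1%:R *
    expR (- (eps * n%:R / 64)) <= beta / 4.
Proof.
have /andP[b0 b2] := beta2.
have r0 : 0 < r := lt_trans ltr01 r1.
(* [K] hides the numeral until the numerical checks; 1024 is large enough for 129 / K <= 1/4 at the
   end. *)
have [K KE] : {K : R | K = 1024} by exists 1024.
have K0 : 0 < K by rewrite KE ltr0n.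
have hN : (grid_size r (alpha / 64)).+1%:R <= 129 * (r / alpha).
  have h : (grid_size r (alpha / 64))%:R <= 2 * r / (alpha / 64).
    by rewrite truncn_le !divr_ge0// ?mulr_ge0// ltW.
  have e : 2 * r / (alpha / 64) = 128 * (r / alpha) by field; rewrite gt_eqF.
  have : 1 <= r / alpha.
    by rewrite ler_pdivlMr//; have := r1; have := alpha1; lra.
  by rewrite -natr1; lra.
have hexp : expR (- (eps * n%:R / 64)) <= beta * (alpha / K) / r.
  (* The three exponents pay for [beta], for the grid spacing through exp(K / alpha) >= K / alpha,
     and for the range [r]. *)
  apply: (@le_trans _ _ (expR (- L + - (K / alpha) + - ln r))).
    rewrite ler_expR -!opprD lerN2; apply: le_trans n3.
    have L2 := L_ge.
    have lr : 0 <= ln r by rewrite ln_ge0// ltW.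
    have ia : 1 <= alpha^-1 by rewrite invf_ge1.
    have h1 : alpha^-1 * (1 / 2) <= L * alpha^-1 by rewrite mulrC ler_wpM2r//; lra.
    have h2 : L * 1 <= L * alpha^-1 by rewrite ler_wpM2l//; lra.
    have h3 : ln r * (1 / 2) <= ln r * L by rewrite ler_wpM2l.
    by rewrite KE; lra.
  rewrite !expRD expRNL [expR (- ln r)]expRN lnK ?posrE//.
  rewrite ler_wpM2r ?invr_ge0 ?(ltW r0)// ler_wpM2l ?(ltW b0)//.
  rewrite expRN -[alpha / K]invf_div lef_pV2 ?posrE ?expR_gt0 ?divr_gt0//.
  by have := expR_ge1Dx (K / alpha); lra.
apply: (le_trans (ler_pM _ _ hN hexp)) => //.
rewrite (_ : _ * _ = 129 / K * beta); last by field; rewrite !gt_eqF.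
by rewrite KE; lra.
Qed.

(** The failure budget is beta/4 + beta/4 for the coins and 3 beta/16 for the samples. *)
Lemma huber_parameters_ok (q := expR (- (eps * n%:R / 16 * (alpha / 64 / (64 / a)))))
    (eta := 4 * q + (grid_size r (alpha / 64)).+1%:R *
              expR (- (eps * n%:R / 64))) :
  [/\ q <= 1 / 2, eta <= 1 &
   eta + (2 * expR (- (8 * (n%:R * (alpha / 256) ^+ 2))) + expR (- (n%:R / 4)))
     <= beta].
Proof.
have /andP[b0 b2] := beta2; have L2 := L_ge.
have e1 : expR (- (8 * (n%:R * (alpha / 256) ^+ 2))) <= beta / 16.
  by rewrite -expRNL; apply: expRN_le_div16; rewrite ?expRNL//; have := n1; lra.
have e3 : expR (- (n%:R / 4)) <= beta / 16.
  by rewrite -expRNL; apply: expRN_le_div16; rewrite ?expRNL//; have := n1'; lra.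
have := q_le; have := grid_term_le; rewrite -/q => g4 q16.
by split; rewrite /eta; lra.
Qed.

End sample_size.

(** With a = alpha^(1/(k-1)) and rho = 64 / a, the conditions on [rho] follow from alpha <= a <= 1
    and alpha rho^(k-1) = 64^(k-1) >= 64; moreover alpha^(k/(k-1)) = a alpha. *)
Lemma huber_mechanism_sample_complexity {d : measure_display}
    {T : measurableType d} {R : realType} (P : probability T R)
    (D : probability (measurableTypeR R) R) (n : nat)
    (X : 'I_n -> {RV P >-> measurableTypeR R})
    (k r eps alpha gamma beta mu : R) :
  2 <= k -> 1 < r -> 0 < eps -> 0 < alpha <= 1 -> alpha <= gamma ->
  0 < beta <= 1 / 2 -> - r <= mu <= r -> has_mean D mu ->
  ('E_D[fun x => (`|(x : R) - mu| `^ k)%R] <= 1)%E ->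
  16 * 256 ^+ 2 * (ln (1 / beta) / alpha ^+ 2
    + ln (1 / beta) / (eps * alpha `^ (k / (k - 1)))
    + ln r * ln (1 / beta) / eps) <= n%:R ->
  iid_samples D X ->
  ((1 - beta)%:E <= output_probability
     (huber_mechanism n r (64 / alpha `^ (k - 1)^-1) (alpha / 64) eps) X
     [set m : measurableTypeR R | (`|mu - (m : R)| <= gamma)%R])%E.
Proof.
move=> k2 r1 eps0 /[dup] alpha01 /andP[alpha0 alpha1] ag beta2 hmu mean mom hn iid.
have k1 : 1 <= k - 1 by lra.
have k10 : 0 < k - 1 by lra.
set a := alpha `^ (k - 1)^-1.
have a0 : 0 < a by rewrite powR_gt0.
have a1 : a <= 1.
  have <- : 1 `^ (k - 1)^-1 = 1 :> R by rewrite powR1.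
  apply: ge0_ler_powR => //.
  - by rewrite invr_ge0 ltW.
  - by rewrite nnegrE ltW.
  - by rewrite nnegrE.
have aE : a `^ (k - 1) = alpha.
  by rewrite /a -powRrM mulVf ?gt_eqF// powRr1// ltW.
have alphaa : alpha <= a.
  rewrite -[leLHS]aE -[leRHS](powRr1 (ltW a0)).
  by apply: ger_powR; rewrite ?a0 ?a1.
have aalpha : alpha `^ (k / (k - 1)) = a * alpha.
  have -> : k / (k - 1) = (k - 1)^-1 + 1 by field; rewrite gt_eqF.
  by rewrite powRD ?(gt_eqF alpha0) ?implybT// powRr1// ltW.
rewrite aalpha in hn.
have a01 : 0 < a <= 1 by rewrite a0 a1.
have [q2 eta1 total] := huber_parameters_ok eps alpha a beta r n eps0 alpha01 a01
  r1 beta2 _ (erefl _) hn.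
apply: le_trans (huber_mechanism_success P D n X k r (64 / a) alpha gamma eps mu
  k2 eps0 alpha01 ag _ _ _ hmu mean mom iid q2 eta1).
- by rewrite lee_fin lerB.
- by rewrite ler_pdivlMr// ler_piMr.
- by rewrite mulrCA ler_piMr// ler_pdivrMr// mul1r.
- rewrite -{1}aE -powRM ?(ltW a0) ?divr_ge0 ?(ltW a0)//.
  rewrite mulrCA divff ?gt_eqF// mulr1.
  by rewrite -[leLHS](powRr1 (ler0n R 64)); apply: ler_powR => //; rewrite ler1n.
Qed.

(* The constant c is absolute, and the algorithm does not depend on D.
   [hbeta] and [halpha] each remove a corner of the parameter space in which
   no absolute c can work.
   - beta close to 1: let k = 2, alpha = 1/2, eps = 1, n = 1. By privacy the success
     probabilities at the ~ r point masses on even integers of [-r, r] sum to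
     at most e, whereas beta = exp (- 1 / (c (8 + ln r))) is allowed.
   - alpha and eps both large: let k = 2, n = 1, r = 2 alpha. The laws with
     mean 2 alpha, resp. - 2 alpha, which are 0 with probability
     p = 1 / (1 + 4 alpha ^ 2) and constant otherwise, force a failure
     probability of p / 2, whereas beta = exp (- alpha ^ 2 / (2 c)) is allowed
     once eps is large enough. *)
Theorem theorem3p5 (R : realType) :
  exists2 c : R, 0 < c &
  forall (k r : R) (hk : 2 <= k) (hr : 1 < r)
    (eps alpha beta : R) (eps0 : 0 < eps) (alpha0 : 0 < alpha) (beta0 : 0 < beta)
    (hbeta : beta <= 1 / 2 \/ 1 <= beta)
    (halpha : [\/ alpha <= 1, eps <= 1 | r <= alpha]),
  exists M : forall n : nat, mechanism R n,
    (forall n : nat, differentially_private eps (M n)) /\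
    forall (D : probability (measurableTypeR R) R) (mu : R),
      - r <= mu <= r ->
      has_mean D mu ->
      ('E_D[fun x => (`|(x : R) - mu| `^ k)%R] <= 1)%E ->
    forall n : nat,
      c * (ln (1 / beta) / alpha ^+ 2
           + ln (1 / beta) / (eps * alpha `^ (k / (k - 1)))
           + ln r * ln (1 / beta) / eps) <= n%:R ->
    forall (d : measure_display) (T : measurableType d) (P : probability T R)
      (X : 'I_n -> {RV P >-> measurableTypeR R}),
      iid_samples D X ->
      ((1 - beta)%:E <=
         output_probability (M n) X
           [set muhat : measurableTypeR R | (`|mu - (muhat : R)| <= alpha)%R])%E.
Proof.
(* The factor 8 is spent when [alpha > 1], where the mechanism runs at accuracy 1. *)
exists (8 * (16 * 256 ^+ 2)).
  apply: mulr_gt0; first by rewrite ltr0n.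
  by apply: mulr_gt0; [rewrite ltr0n|apply: exprn_gt0; rewrite ltr0n].
move=> k r k2 r1 eps alpha beta eps0 alpha0 beta0 hbeta halpha.
have r0 : 0 < r := lt_trans ltr01 r1.
have [b1|b1] := leP 1 beta.
  exists (fun n => huber_mechanism n 0 1 1 eps); split.
    by move=> n; exact: huber_mechanism_private.
  move=> D mu _ _ _ n _ d T P X _; apply: (@le_trans _ _ 0%E).
    by rewrite lee_fin subr_le0.
  exact: integral_ge0.
have {hbeta b1} beta2 : 0 < beta <= 1 / 2.
  by case: hbeta => [->|]; [rewrite beta0|rewrite leNgt b1].
have [ralpha|alphar] := leP r alpha.
  (* With range 0 the grid is the single point 0, which is within [r <= alpha] of [mu]. *)
  exists (fun n => huber_mechanism n 0 1 1 eps); split.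
    by move=> n; exact: huber_mechanism_private.
  move=> D mu murmu _ _ n _ d T P X _.
  have h x : huber_mechanism n 0 1 1 eps x
      [set m : measurableTypeR R | (`|mu - (m : R)| <= alpha)%R] = 1%E.
    rewrite exponential_mechanismE /grid_size mulr0 mul0r truncn0.
    rewrite -[RHS](congr1 EFin (softmax_sum1 0 (huber_score n 0 1 1 eps) x)).
    congr EFin; apply: eq_bigr => j _; rewrite indicE mem_set ?mulr1//=.
    rewrite ord1 /grid mul0r addr0 oppr0 subr0 ler_norml.
    by apply/andP; split; lra.
  rewrite /output_probability; under eq_integral do rewrite h.
  rewrite (_ : \int[P]_w 1 = 1)%E; last first.
    transitivity (1 * P setT)%E; first exact: integral_cst.
    by rewrite probability_setT mule1.
  by rewrite lee_fin; lra.
pose alpha' := Num.min alpha 1.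
have alpha'01 : 0 < alpha' <= 1.
  by rewrite /alpha' lt_min alpha0 ltr01 ge_min lexx orbT.
exists (fun n => huber_mechanism n r (64 / alpha' `^ (k - 1)^-1) (alpha' / 64) eps).
split; first by move=> n; exact: huber_mechanism_private.
move=> D mu hmu mean mom n hn d T P X iid.
apply: (huber_mechanism_sample_complexity P D n X k r eps alpha' alpha) => //.
  by rewrite ge_min lexx.
apply: le_trans hn.
have : 0 <= 16 * 256 ^+ 2 :> R by apply: mulr_ge0 (ler0n _ _) (sqr_ge0 _).
move: (16 * 256 ^+ 2) => c c0.
rewrite [8 * c]mulrC -[leRHS]mulrA; apply: ler_wpM2l => //.
set L := ln (1 / beta).
have L0 : 0 <= L.
  apply: ln_ge0; rewrite ler_pdivlMr// mul1r; lra.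
have lr0 : 0 < ln r by rewrite ln_gt0.
have t1 : 0 <= L / alpha ^+ 2 by rewrite divr_ge0// sqr_ge0.
have t2 : 0 <= L / (eps * alpha `^ (k / (k - 1))).
  by rewrite divr_ge0// mulr_ge0 ?powR_ge0 ?ltW.
have t3 : 0 <= ln r * L / eps by rewrite divr_ge0 ?mulr_ge0 ?(ltW lr0) ?(ltW eps0).
have [a1|a1] := leP alpha 1.
  by rewrite /alpha' min_l//; lra.
have eps1 : eps <= 1 by case: halpha => //; [rewrite leNgt a1|rewrite leNgt alphar].
rewrite /alpha' min_r ?(ltW a1)// expr1n powR1 divr1 mulr1.
have Leps : L <= L / eps by rewrite ler_pdivlMr// ler_piMr.
(* The terms L + L/eps <= 2 L/eps must be absorbed: for r >= 2 by the [ln r] term, and for r < 2 by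
   the middle term, since then alpha < 2 and alpha^(k/(k-1)) <= alpha^2 <= 4. *)
have [r2|r2] := leP 2 r.
  have lr2 : 1 / 2 <= ln r.
    rewrite -ler_expR lnK ?posrE// (le_trans _ r2)//.
    by have := expR_le_quadratic _ (lexx (1 / 2 : R)); lra.
  have : 1 / 2 * (L / eps) <= ln r * L / eps.
    by rewrite -[leRHS]mulrA ler_wpM2r// divr_ge0// ltW.
  lra.
have p4 : alpha `^ (k / (k - 1)) <= 4.
  apply: (@le_trans _ _ (alpha `^ 2)).
    apply: ler_powR; first exact: ltW.
    by rewrite ler_pdivrMr; lra.
  by rewrite powR_mulrn ?(ltW alpha0)// expr2; nra.
have p0 : 0 < alpha `^ (k / (k - 1)) by rewrite powR_gt0.
have : 1 / 4 * (L / eps) <= L / (eps * alpha `^ (k / (k - 1))).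
  rewrite invfM [leRHS]mulrA mulrC; apply: ler_wpM2l.
    by rewrite divr_ge0// ltW.
  by rewrite div1r lef_pV2 ?posrE.
lra.
Qed.
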